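(* Let $M=\prod_{j=1}^Kp_j^{n_j}$ and $i\in\{1,\dots,K\}$. Assume $A\oplus B=\mathbb{Z}_M$ and $\Phi_{p_i^{n_i}}(X)\mid A(X)$. Then the following are equivalent: (i) For every translate $A'=A+t$ ($t\in\mathbb{Z}_M$) of $A$, we have $A'_{p_i}\oplus B=\mathbb{Z}_{M/p_i}$ (with $A'_{p_i}$ and $B$ reduced mod $M/p_i$). (ii) For every $d$ with $p_i^{n_i}\mid d\mid M$, at least one of the following holds: $\Phi_d(X)\mid A(X)$, or $\Phi_{d/p_i}\Phi_{d/p_i^2}\cdots\Phi_{d/p_i^{n_i}}(X)\mid B(X)$. (iii) For every $m$ with $p_i^{n_i}\mid m\mid M$: if $m\in\mathrm{Div}(A)$ then $m/p_i\notin\mathrm{Div}(B)$.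
   Context: $p_j$ are distinct primes, $n_j\ge1$; $M_j=M/p_j^{n_j}$. Each $x\in\mathbb{Z}_M$ is written uniquely as $x=\sum_{j}\pi_j(x)M_j$ with $\pi_j(x)\in\mathbb{Z}_{p_j^{n_j}}=\{0,\dots,p_j^{n_j}-1\}$ (array coordinates). For $A'\subset\mathbb{Z}_M$, $A'_{p_i}=\{a\in A':0\le\pi_i(a)\le p_i^{n_i-1}-1\}$. Sets are identified with subsets of $\{0,\dots,M-1\}$, mask polynomial $A(X)=\sum_{a\in A}X^a$. $A\oplus B=\mathbb{Z}_M$ means each element of $\mathbb{Z}_M$ is uniquely $a+b$; for $N\mid M$, ''$C\oplus D=\mathbb{Z}_N$'' for $C,D\subset\mathbb{Z}_M$ means the reductions of $C$ and $D$ mod $N$ are sets (no two elements congruent mod $N$) and tile $\mathbb{Z}_N$ in this sense. $\mathrm{Div}(A)=\{\gcd(a-a',M):a,a'\in A\}$. $\Phi_s$ is the $s$-th cyclotomic polynomial. *)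

(* Defs.v *)
From HB Require Import structures.
From mathcomp Require Import all_boot all_order all_algebra all_field.

Set Implicit Arguments.
Unset Strict Implicit.
Unset Printing Implicit Defensive.

Import GRing.Theory.

Local Open Scope nat_scope.

(* Z_M is 'Z_M, whose elements coerce to their representatives in             *)
(* {0, ..., M - 1}; this is only meaningful for 1 < M, which holds whenever M *)
(* is a nonempty product of positive powers of primes.                        *)

Definition mask_poly (M : nat) (A : {set 'Z_M}) : {poly int} :=
  (\sum_(a in A) 'X^(a : nat))%R.

(* On {poly int}, %| tests that a pseudo-remainder vanishes; for a monic      *)
(* divisor, such as a product of cyclotomic polynomials, it is genuine        *)
(* divisibility in Z[X].                                                      *)
Lemma monic_dvdpP (q r : {poly int}) :
  q \is monic -> reflect (exists s, r = (s * q)%R) (q %| r)%R.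
Proof.
move=> q_monic; apply: (iffP idP) => [|[s ->]]; last exact: dvdp_mulIr.
move=> /modp_eq0P r0; exists (r %/ q)%R.
by rewrite [LHS](Pdiv.IdomainMonic.divp_eq q_monic) r0 addr0.
Qed.

Definition tiling (M : nat) (A B : {set 'Z_M}) : Prop :=
  forall x : 'Z_M,
    exists! u : 'Z_M * 'Z_M, [/\ u.1 \in A, u.2 \in B & (u.1 + u.2)%R = x].

(* C (+) D = Z_N for subsets C, D of Z_M and N %| M. Congruences on natural   *)
(* representatives are used rather than 'Z_N because N may be 1, and 'Z_1 is  *)
(* not the trivial ring. Since reduction mod N is injective on C and on D,    *)
(* pairs in C x D are the same as pairs of reductions.                        *)
Definition tiling_mod (M N : nat) (C D : {set 'Z_M}) : Prop :=
  [/\ {in C &, forall c c' : 'Z_M, c = c' %[mod N] -> c = c'},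
      {in D &, forall d d' : 'Z_M, d = d' %[mod N] -> d = d'}
    & forall x : 'I_N,
        exists! u : 'Z_M * 'Z_M,
          [/\ u.1 \in C, u.2 \in D & (u.1 : nat) + u.2 = x %[mod N]]].

Definition translate (M : nat) (A : {set 'Z_M}) (t : 'Z_M) : {set 'Z_M} :=
  [set (a + t)%R | a in A].

Definition Div (M : nat) (A : {set 'Z_M}) : seq nat :=
  [seq gcdn (a - a' : 'Z_M)%R M | a <- enum A, a' <- enum A].

Section ArrayCoordinates.

Variables (K : nat) (p n : 'I_K -> nat) (M : nat).

Definition array_coords (x : 'Z_M)
    (c : {dffun forall j : 'I_K, 'I_(p j ^ n j)}) : bool :=
  x == (\sum_j (c j * (M %/ p j ^ n j))%N%:R)%R.

(* The default value 0 is never used when M = \prod_j p j ^ n j with the p j  *)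
(* distinct primes: see array_coords_exists_unique and array_coordE.          *)
Definition array_coord (i : 'I_K) (x : 'Z_M) : nat :=
  if [pick c | array_coords x c] is Some c then c i else 0.

Definition low_part (i : 'I_K) (A : {set 'Z_M}) : {set 'Z_M} :=
  [set a in A | array_coord i a <= p i ^ (n i).-1 - 1].

Hypotheses (p_prime : forall j, prime (p j)) (p_inj : injective p).
Hypotheses (M_gt1 : 1 < M) (defM : M = \prod_j p j ^ n j).

Lemma array_coords_inj x c c' :
  array_coords x c -> array_coords x c' -> c = c'.
Proof.
move=> /eqP-> /eqP; rewrite -!natr_sum => /(congr1 val) /=.
rewrite !val_Zp_nat // => eqM; apply/ffunP => i; apply/val_inj => /=.
have dvM j : p j ^ n j %| M by rewrite defM (bigD1 j) //= dvdn_mulr.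
have divM j : M %/ p j ^ n j = \prod_(k | k != j) p k ^ n k.
  by rewrite {1}defM (bigD1 j) //= mulKn // expn_gt0 prime_gt0.
have redi (e : {dffun forall j : 'I_K, 'I_(p j ^ n j)}) :
    \sum_j e j * (M %/ p j ^ n j) = e i * (M %/ p i ^ n i) %[mod p i ^ n i].
  rewrite (bigD1 i) //= -modnDmr.
  have /eqP-> : p i ^ n i %| \sum_(j | j != i) e j * (M %/ p j ^ n j).
    apply: dvdn_sum => j ji; rewrite divM dvdn_mull //.
    by rewrite (bigD1 i) 1?eq_sym //= dvdn_mulr.
  by rewrite addn0.
have {}eqM : c i * (M %/ p i ^ n i) = c' i * (M %/ p i ^ n i) %[mod p i ^ n i].
  by rewrite -!redi -(modn_dvdm _ (dvM i)) eqM modn_dvdm.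
have cop : coprime (p i ^ n i) (M %/ p i ^ n i).
  rewrite divM; apply: (big_ind (coprime _)) => [|a b ca cb|k ki].
  - exact: coprimen1.
  - by rewrite coprimeMr ca.
  rewrite coprimeXl // coprimeXr // prime_coprime // dvdn_prime2 //.
  by apply: contraNN ki => /eqP/p_inj->.
have {eqM} : c i = c' i %[mod p i ^ n i].
  wlog le : c c' eqM / c i <= c' i.
    by move=> W; case/orP: (leq_total (c i) (c' i)) => le;
       [apply: W | symmetry; apply: W].
  apply/esym/eqP; rewrite eqn_mod_dvd //.
  move/esym/eqP: eqM; rewrite eqn_mod_dvd ?leq_mul2r ?le ?orbT //.
  by rewrite -mulnBl Gauss_dvdl.
by rewrite !modn_small.
Qed.

Lemma array_coords_exists_unique x : exists! c, array_coords x c.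
Proof.
pose F (c : {dffun forall j : 'I_K, 'I_(p j ^ n j)}) : 'Z_M :=
  (\sum_j (c j * (M %/ p j ^ n j))%N%:R)%R.
have Finj : injective F.
  move=> c c' eqF; apply: (@array_coords_inj (F c)); rewrite /array_coords.
    exact: eqxx.
  by apply/eqP.
have cardE : #|'Z_M| <= #|{dffun forall j : 'I_K, 'I_(p j ^ n j)}|.
  rewrite card_dep_ffun foldrE big_map card_ord Zp_cast // {1}defM big_enum /=.
  by apply: leq_prod => j _; rewrite card_ord.
have /codomP[c ->] := inj_card_onto Finj cardE x.
by exists c; split=> [|c']; [apply/eqP | apply: array_coords_inj; apply/eqP].
Qed.

Lemma array_coordE x c i : array_coords x c -> array_coord i x = c i.
Proof.
rewrite /array_coord; case: pickP => [c' xc' xc | /(_ c)->//].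
by rewrite (array_coords_inj xc' xc).
Qed.

End ArrayCoordinates.

(* Main.v *)
(* Write p = p_i, P = p ^ n_i, q = P / p, c = M / P. By Fourier analysis on Z_N,
   C (+) D = Z_N iff |C| |D| = N and C(z) D(z) = 0 for all N-th roots of unity
   z <> 1.

   (i) <-> (ii). For z with z ^ c = 1, let f_z(r) be the sum of z ^ a over the
   a in A with i-th coordinate r mod P. If z has order d', then Phi_(d' P) | A
   iff f_z is q-periodic: f_z(r + q) - f_z(r) has Fourier transform supported on
   the primitive P-th roots of unity w, where it is a nonzero multiple of
   A(z w). Periodicity gives A(z w) = p A_p(z w) for w ^ q = 1, so zeros of A
   pass to A_p. Conversely, if A'_p(z w) = 0 for every translate A', then all
   sums of f_z(r) w ^ (r c) over q consecutive r vanish, and subtracting two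
   neighbouring ones gives the periodicity of f_z.

   (i) <-> (iii). This follows from the theorem of Sands, applied in Z_M and in
   Z_(M/p): in a tiling Z_N = C (+) D no proper divisor of N is both a
   gcd(c - c', N) and a gcd(d - d', N). *)

Require Import Defs.
From mathcomp Require Import all_boot all_order all_algebra all_field.
From mathcomp Require Import ring.

Set Implicit Arguments.
Unset Strict Implicit.
Unset Printing Implicit Defensive.

Import GRing.Theory Num.Theory.

Local Open Scope nat_scope.

(** * Mask polynomials at roots of unity and divisibility by cyclotomic polynomials *)

Definition mask_eval (M : nat) (A : {set 'Z_M}) (z : algC) : algC :=
  (\sum_(a in A) z ^+ (a : nat))%R.

Lemma map_poly_intr_ratr (s : {poly int}) :
  map_poly (intr : int -> algC) s =
  map_poly (ratr : rat -> algC) (map_poly (intr : int -> rat) s).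
Proof.
by rewrite -map_poly_comp; apply: eq_map_poly => x /=; rewrite ratr_int.
Qed.

Lemma dvdp_intr_algC (q r : {poly int}) :
  (map_poly (intr : int -> algC) q %| map_poly (intr : int -> algC) r)%R
    = (q %| r)%R.
Proof.
by rewrite !map_poly_intr_ratr dvdp_map dvdp_rat_int.
Qed.

(** Over the rationals ['Phi_d] is the minimal polynomial of [z], and divisibility may be tested
    after extending scalars. *)
Lemma Cyclotomic_dvd_horner d (z : algC) (s : {poly int}) :
  d.-primitive_root%R z ->
  ('Phi_d %| s)%R = ((map_poly (intr : int -> algC) s).[z] == 0)%R.
Proof.
move=> zP; rewrite -dvdp_intr_algC (Cintr_Cyclotomic zP).
rewrite -(minCpoly_cyclotomic zP).
have [q [-> _] qP] := minCpolyP z.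
by rewrite map_poly_intr_ratr dvdp_map -qP.
Qed.

Lemma Cyclotomic_dvd_mask M (A : {set 'Z_M}) d (z : algC) :
  d.-primitive_root%R z -> ('Phi_d %| mask_poly A)%R = (mask_eval A z == 0)%R.
Proof.
move=> zP; rewrite (Cyclotomic_dvd_horner _ zP) /mask_poly rmorph_sum horner_sum.
by congr (_ == _)%R; apply: eq_bigr => a _; rewrite /= map_polyXn hornerXn.
Qed.

(** Both [z] and [z ^+ r] have order [d], so each vanishing amounts to divisibility by the same
    ['Phi_d]. *)
Lemma mask_eval_eq0_exp M (A : {set 'Z_M}) d r (z : algC) :
  d.-primitive_root%R z -> coprime r d ->
  (mask_eval A (z ^+ r) == 0)%R = (mask_eval A z == 0)%R.
Proof.
move=> zP co; rewrite -(Cyclotomic_dvd_mask A zP) -(@Cyclotomic_dvd_mask _ A d) //.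
by rewrite prim_root_exp_coprime.
Qed.

Lemma prim_root_order_unique (z : algC) d e :
  d.-primitive_root%R z -> e.-primitive_root%R z -> d = e.
Proof.
move=> zd ze; apply/eqP; rewrite eqn_dvd (prim_order_dvd zd) (prim_order_dvd ze).
by rewrite (prim_expr_order zd) (prim_expr_order ze) !eqxx.
Qed.

Lemma coprimep_Cyclotomic d e : 0 < d -> 0 < e -> d != e ->
  coprimep (map_poly (intr : int -> algC) 'Phi_d)
           (map_poly (intr : int -> algC) 'Phi_e).
Proof.
move=> d0 e0 de; have [z zP] := C_prim_root_exists d0.
have [w wP] := C_prim_root_exists e0.
rewrite (Cintr_Cyclotomic zP) (Cintr_Cyclotomic wP).
apply/Pdiv.ClosedField.coprimepP => x; rewrite (root_cyclotomic zP) => xd.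
apply: contraNN de => xe; apply/eqP; apply: prim_root_order_unique xd _.
by rewrite -(root_cyclotomic wP).
Qed.

(** Distinct cyclotomic polynomials are coprime, since a common root would have two orders. *)
Lemma prod_Cyclotomic_dvd (ds : seq nat) (s : {poly int}) :
  uniq ds -> {in ds, forall d, 0 < d} ->
  ((\prod_(d <- ds) 'Phi_d) %| s)%R = all (fun d => 'Phi_d %| s)%R ds.
Proof.
elim: ds => [|d ds IH] /=; first by rewrite big_nil dvd1p.
case/andP=> dds uds ds0; rewrite big_cons -IH //; last first.
  by move=> e eds; apply: ds0; rewrite inE eds orbT.
rewrite -!dvdp_intr_algC rmorphM /= Gauss_dvdp //.
rewrite rmorph_prod /= big_seq.
apply: (big_ind (coprimep (map_poly _ 'Phi_d))) => [|x y cx cy|e eds].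
- exact: coprimep1.
- by rewrite coprimepMr cx.
apply: coprimep_Cyclotomic; rewrite ?ds0 ?inE ?eqxx ?eds ?orbT //.
by apply: contraNneq dds => ->.
Qed.

(** If [(z * w) ^+ m = 1], raising to the power [e] removes [w] and gives [d %| e * m], hence
    [d %| m]; symmetrically [e %| m]. *)
Lemma prim_root_mul d e (z w : algC) :
  d.-primitive_root%R z -> e.-primitive_root%R w -> coprime d e ->
  (d * e).-primitive_root%R (z * w)%R.
Proof.
move=> zP wP co; have d0 := prim_order_gt0 zP; have e0 := prim_order_gt0 wP.
have zw1 : ((z * w) ^+ (d * e) = 1)%R.
  by rewrite exprMn exprM (prim_expr_order zP) expr1n mul1r mulnC exprM
             (prim_expr_order wP) expr1n.
have [|m mP mde] := @prim_order_exists _ (d * e) _ _ zw1;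
  first by rewrite muln_gt0 d0.
suff -> : d * e = m by [].
apply/eqP; rewrite eqn_dvd mde andbT Gauss_dvd //.
have zwm := prim_expr_order mP.
apply/andP; split.
  rewrite -(Gauss_dvdr _ co) (prim_order_dvd zP); apply/eqP.
  move/(congr1 (fun x => x ^+ e)%R): zwm.
  rewrite -exprM expr1n exprMn [in X in (_ * X)%R]mulnC.
  by rewrite [(w ^+ _)%R]exprM (prim_expr_order wP) expr1n mulr1 mulnC.
rewrite coprime_sym in co.
rewrite -(Gauss_dvdr _ co) (prim_order_dvd wP); apply/eqP.
move/(congr1 (fun x => x ^+ d)%R): zwm.
rewrite -exprM expr1n exprMn [in X in (X * _)%R]mulnC.
by rewrite [(z ^+ _)%R]exprM (prim_expr_order zP) expr1n mul1r mulnC.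
Qed.

(** * Fourier inversion and the vanishing criterion for tilings *)

Lemma expr_modn (z : algC) N k : (z ^+ N = 1)%R -> (z ^+ (k %% N) = z ^+ k)%R.
Proof.
by move=> zN; rewrite [in RHS](divn_eq k N) exprD mulnC exprM zN expr1n mul1r.
Qed.

Lemma eq_expr_mod (z : algC) N k l :
  (z ^+ N = 1)%R -> k = l %[mod N] -> (z ^+ k = z ^+ l)%R.
Proof. by move=> zN kl; rewrite -(expr_modn k zN) kl expr_modn. Qed.

(** The polynomial with coefficients [f x] has degree below [N] and vanishes at all [N] distinct
    powers of a primitive root, so it is zero. *)
Lemma fourier_eq0 N (f : nat -> algC) :
  (forall z : algC, z ^+ N = 1 -> \sum_(x < N) f x * z ^+ x = 0)%R ->
  forall x, x < N -> f x = 0%R.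
Proof.
move=> f0 x xN; have N0 : 0 < N by apply: leq_ltn_trans xN.
have [w wP] := C_prim_root_exists N0.
pose F := (\poly_(i < N) f i)%R.
suff F0 : F = 0%R by have := coef_poly N f x; rewrite -/F F0 coef0 xN.
apply: (@roots_geq_poly_eq0 _ _ [seq (w ^+ i)%R | i <- iota 0 N]).
- apply/allP => _ /mapP[i _ ->]; rewrite rootE horner_poly f0 //.
  by rewrite exprAC (prim_expr_order wP) expr1n.
- rewrite map_inj_in_uniq ?iota_uniq // => i j; rewrite !mem_iota !add0n /= => iN jN.
  by move/eqP; rewrite (eq_prim_root_expr wP) !modn_small // => /eqP.
by rewrite size_map size_iota size_poly.
Qed.

Lemma sum_unity_root N (z : algC) : (z ^+ N = 1)%R -> z != 1%R ->
  (\sum_(x < N) z ^+ x = 0)%R.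
Proof.
move=> zN z1; have := subrX1 z N; rewrite zN subrr => /esym/eqP.
by rewrite mulf_eq0 subr_eq0 (negPf z1) /= => /eqP.
Qed.

(** Ordinary representations are the case [r = 1]; a general multiplier [r] on [D] serves the
    theorem of Sands. *)
Definition sum_reps (M : nat) (C D : {set 'Z_M}) (r N x : nat) :
    {set 'Z_M * 'Z_M} :=
  [set u | [&& u.1 \in C, u.2 \in D & u.1 + r * u.2 == x %[mod N]]].

Lemma fourier_sum_reps M (C D : {set 'Z_M}) r N (z : algC) :
  0 < N -> (z ^+ N = 1)%R ->
  (\sum_(x < N) #|sum_reps C D r N x|%:R * z ^+ x
    = mask_eval C z * mask_eval D (z ^+ r))%R.
Proof.
move=> N0 zN; rewrite /mask_eval big_distrlr /= pair_big /=.
pose h (u : 'Z_M * 'Z_M) : 'I_N := Ordinal (ltn_pmod (u.1 + r * u.2) N0).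
rewrite (partition_big h xpredT) //=; apply: eq_bigr => x _.
rewrite mulr_natl -sumr_const.
apply: eq_big => [u|u].
  by rewrite inE andbA -(inj_eq val_inj) /= (modn_small (ltn_ord x)).
rewrite inE => /and3P[_ _ /eqP ux].
by rewrite -exprM -exprD; apply: eq_expr_mod zN _.
Qed.

(** The count of representations has transform C(z) D(z^r), while the constant 1 has transform [N]
    at [z = 1] and 0 at the other roots. Fourier inversion makes equality of transforms equality of
    functions. *)
Lemma sum_reps_tilingP M (C D : {set 'Z_M}) r N : 0 < N ->
  (forall x, x < N -> #|sum_reps C D r N x| = 1) <->
  #|C| * #|D| = N /\
  (forall z : algC, z ^+ N = 1 -> z != 1 ->
     mask_eval C z * mask_eval D (z ^+ r) = 0)%R.
Proof.
move=> N0.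
have card1 : (mask_eval C 1 * mask_eval D (1 ^+ r) = (#|C| * #|D|)%:R)%R.
  rewrite /mask_eval expr1n; under eq_bigr do rewrite expr1n.
  by under [in X in (_ * X)%R]eq_bigr do rewrite expr1n; rewrite !sumr_const -natrM.
have sum1 : (\sum_(x < N) (1 : algC) ^+ x = N%:R)%R.
  by under eq_bigr do rewrite expr1n; rewrite sumr_const card_ord.
split=> [reps1 | [CD vanish] x xN].
  have transform (z : algC) : (z ^+ N = 1)%R ->
      (mask_eval C z * mask_eval D (z ^+ r) = \sum_(x < N) z ^+ x)%R.
    move=> zN; rewrite -(fourier_sum_reps _ _ _ N0 zN).
    by apply: eq_bigr => x _; rewrite reps1 // mul1r.
  split=> [|z zN z1]; last by rewrite transform // sum_unity_root.
  apply/eqP; rewrite -(eqr_nat algC) -card1 transform ?expr1n //.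
  by rewrite sum1.
pose f x : algC := (#|sum_reps C D r N x|%:R - 1)%R.
suff /eqP : f x = 0%R by rewrite subr_eq0 pnatr_eq1 => /eqP.
apply: fourier_eq0 (xN) => z zN; rewrite /f.
under eq_bigr do rewrite mulrBl mul1r.
rewrite sumrB fourier_sum_reps //; have [->|z1] := eqVneq z 1%R.
  by rewrite card1 CD sum1 subrr.
by rewrite vanish // sum_unity_root // subrr.
Qed.

Lemma tiling_mod_reps M (C D : {set 'Z_M}) N : 0 < N ->
  tiling_mod N C D <-> forall x, x < N -> #|sum_reps C D 1 N x| = 1.
Proof.
move=> N0; split=> [[_ _ ex1] x xN | reps1].
  have [u [[uC uD ux] uniqu]] := ex1 (Ordinal xN).
  apply/eqP/cards1P; exists u; apply/setP => v; rewrite !inE mul1n.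
  apply/and3P/eqP => [[vC vD /eqP vx] | ->]; first by apply/esym/uniqu.
  by split=> //; apply/eqP.
have [card _] := (sum_reps_tilingP C D 1 N0).1 reps1.
(* Injectivity of reduction on one set follows by pairing with a fixed element of the other; both
   are nonempty because [#|C| * #|D| = N > 0]. *)
have inj (u v : 'Z_M * 'Z_M) : u.1 \in C -> u.2 \in D -> v.1 \in C ->
    v.2 \in D -> u.1 + u.2 = v.1 + v.2 %[mod N] -> u = v.
  move=> uC uD vC vD uv.
  have /eqP/cards1P[w wP] := reps1 _ (ltn_pmod (v.1 + v.2) N0).
  have : u \in [set w] by rewrite -wP inE uC uD mul1n uv modn_mod /=.
  have : v \in [set w] by rewrite -wP inE vC vD mul1n modn_mod /=.
  by rewrite !inE => /eqP-> /eqP->.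
have /andP[/card_gt0P[c0 c0C] /card_gt0P[d0 d0D]] : (0 < #|C|) && (0 < #|D|).
  by rewrite -muln_gt0 card.
split=> [c c' cC c'C cc'|d d' dD d'D dd'|x].
- suff [] : (c, d0) = (c', d0) by [].
  by apply: inj => //=; rewrite -modnDml cc' modnDml.
- suff [] : (c0, d) = (c0, d') by [].
  by apply: inj => //=; rewrite -modnDmr dd' modnDmr.
have /eqP/cards1P[u uP] := reps1 _ (ltn_ord x).
have : u \in [set u] by rewrite inE.
rewrite -uP inE mul1n => /and3P[uC uD /eqP ux].
exists u; split=> // v [vC vD vx]; apply: inj => //; by rewrite ux vx.
Qed.

Lemma tiling_modP M (C D : {set 'Z_M}) N : 0 < N ->
  tiling_mod N C D <->
  #|C| * #|D| = N /\
  (forall z : algC, z ^+ N = 1 -> z != 1 ->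
     mask_eval C z * mask_eval D z = 0)%R.
Proof.
move=> N0; exact: iff_trans (tiling_mod_reps C D N0) (sum_reps_tilingP C D 1 N0).
Qed.

(** * Units modulo [N] and the theorem of Sands *)

Lemma unit_lift s L N : 0 < s -> coprime s L -> L %| N -> 0 < N ->
  exists2 r, coprime r N & r = s %[mod L].
Proof.
(* Among the primes of N, exactly those that do not divide s divide t. *)
move=> s0 sL LN N0; pose t := N`_(\pi(s)^').
exists (s + L * t); last by rewrite addnC mulnC modnMDl.
rewrite coprime_has_primes ?addn_gt0 ?s0 //.
apply/hasPn => q; rewrite !mem_primes N0 => /and3P[q_pr _ qN].
rewrite /= q_pr addn_gt0 s0 /=.
have qt : (q %| t) = ~~ (q %| s).
  have := primes_part (\pi(s)^') N; rewrite -/t => /(congr1 (fun l => q \in l)).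
  rewrite mem_filter !inE /= !mem_primes q_pr s0 N0 qN part_gt0 /= andbT.
  by move=> ->.
have [qs|qs] := boolP (q %| s).
  rewrite dvdn_addr // Euclid_dvdM // qt qs orbF.
  apply: contraL sL => qL; rewrite /coprime gtn_eqF //.
  by rewrite (leq_trans (prime_gt1 q_pr)) // dvdn_leq ?gcdn_gt0 ?s0 // dvdn_gcd qs.
by rewrite dvdn_addl // dvdn_mull // qt.
Qed.

(** After division by the common gcd [m], both numbers are units modulo [N %/ m]; their quotient
    lifts to a unit modulo [N]. *)
Lemma eq_gcd_unit x y N : 0 < N -> gcdn x N = gcdn y N ->
  exists2 r, coprime r N & x = r * y %[mod N].
Proof.
move=> N0 xy; set m := gcdn x N in xy.
have m0 : 0 < m by rewrite gcdn_gt0 N0 orbT.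
have mx : m %| x := dvdn_gcdl x N.
have my : m %| y by rewrite xy dvdn_gcdl.
have mN : m %| N := dvdn_gcdr x N.
have L0 : 0 < N %/ m by rewrite divn_gt0 // dvdn_leq.
have cop u : m %| u -> m = gcdn u N -> coprime (u %/ m) (N %/ m).
  by move=> mu mE; rewrite /coprime -(eqn_pmul2r m0) muln_gcdl !divnK // -mE mul1n.
have cx := cop x mx erefl; have cy := cop y my xy.
(* If [m = N], both numbers vanish modulo [N] and the unit 1 works; this case is split off because
   the quotients by [m] may then be 0. *)
have [L1|L1] := eqVneq (N %/ m) 1.
  have mE : m = N by rewrite -(divnK mN) L1 mul1n.
  exists 1; first exact: coprime1n.
  by move: mx my; rewrite mE mul1n => /eqP-> /eqP->.
have y0 : 0 < y %/ m.
  by rewrite lt0n; apply: contraNneq L1 => e; move: cy; rewrite e /coprime gcd0n.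
have x0 : 0 < x %/ m.
  by rewrite lt0n; apply: contraNneq L1 => e; move: cx; rewrite e /coprime gcd0n.
(* The Bezout coefficient [u] is an inverse of [y %/ m] modulo [N %/ m]. *)
have [u v uv _] := egcdnP (N %/ m) y0.
rewrite (eqP cy) in uv.
have u0 : 0 < u by case: u uv => //; rewrite mul0n addn1.
have cu : coprime u (N %/ m).
  have : coprime (u * (y %/ m)) (N %/ m).
    by rewrite uv coprime_sym /coprime gcdnMDl gcdn1.
  by rewrite coprimeMl => /andP[].
have [||||r rN ru] := @unit_lift (x %/ m * u) (N %/ m) N.
- by rewrite muln_gt0 x0.
- by rewrite coprimeMl cx.
- by apply/dvdnP; exists m; rewrite mulnC divnK.
- exact: N0.
exists r => //.
suff e : x %/ m = r * (y %/ m) %[mod N %/ m].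
  rewrite -(divnK mx) -{1}(divnK mN) -(divnK my) -{2}(divnK mN) mulnA -!muln_modl.
  by rewrite e.
rewrite -modnMml ru modnMml -mulnA uv mulnDr muln1 mulnA.
by rewrite -modnDml modnMl add0n.
Qed.

Lemma val_ZpD M (x y : 'Z_M) : 1 < M -> nat_of_ord (x + y)%R = (x + y) %% M.
Proof. by move=> M1; rewrite /= [X in _ %% X](Zp_cast M1). Qed.

Lemma val_ZpB_add M (x y : 'Z_M) N : 1 < M -> N %| M ->
  (x - y : 'Z_M)%R + y = x %[mod N].
Proof.
by move=> M1 NM; rewrite -(modn_dvdm _ NM) -val_ZpD // subrK.
Qed.

Lemma DivP M (A : {set 'Z_M}) m :
  reflect (exists a a' : 'Z_M, [/\ a \in A, a' \in A & m = gcdn (a - a')%R M])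
          (m \in Div A).
Proof.
apply: (iffP allpairsP) => [[[a a']] /= [] | [a [a' [aA a'A ->]]]].
  by rewrite !mem_enum => aA a'A ->; exists a, a'.
by exists (a, a'); rewrite /= !mem_enum.
Qed.

Lemma tiling_mod_self M (A B : {set 'Z_M}) : 1 < M ->
  tiling A B -> tiling_mod M A B.
Proof.
move=> M1 AB; have inj (x y : 'Z_M) : x = y %[mod M] -> x = y.
  have lt (v : 'Z_M) : v < M by have := ltn_ord v; rewrite [X in _ < X]Zp_cast.
  by rewrite !modn_small // => /val_inj.
split=> [x y _ _|x y _ _|x]; [exact: inj | exact: inj |].
have sumE (u : 'Z_M * 'Z_M) :
    (u.1 + u.2)%R = (x%:R)%R <-> u.1 + u.2 = x %[mod M].
  split=> [/(congr1 (@nat_of_ord _))|e]; first by rewrite val_ZpD // val_Zp_nat.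
  by apply: ord_inj; rewrite val_ZpD // val_Zp_nat.
have [u [[uA uB uE] uniqu]] := AB (x%:R)%R.
exists u; split=> [|v [vA vB vE]]; first by split=> //; apply/sumE.
by apply: uniqu; split=> //; apply/sumE.
Qed.

(* Multiplying D by a unit r mod N preserves the tiling, since z and z ^ r are
   Galois conjugates; choosing r with c - c' = r (d - d') mod N forces two
   representations of the same residue. *)
Lemma tiling_mod_gcd_inj M N (C D : {set 'Z_M}) (c c' d d' : 'Z_M) :
  1 < M -> N %| M -> tiling_mod N C D ->
  c \in C -> c' \in C -> d \in D -> d' \in D ->
  gcdn (c - c' : 'Z_M)%R N = gcdn (d - d' : 'Z_M)%R N -> c = c' /\ d = d'.
Proof.
move=> M1 NM CD cC c'C dD d'D gE.
have N0 : 0 < N by apply: dvdn_gt0 NM; apply: ltnW.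
have [r rN xy] := eq_gcd_unit N0 gE.
have [card vanish] := (tiling_modP C D N0).1 CD.
have reps1 : forall x, x < N -> #|sum_reps C D r N x| = 1.
  apply/sum_reps_tilingP => //; split=> // z zN z1.
  have /eqP := vanish z zN z1; rewrite mulf_eq0.
  have [e zP eN] := prim_order_exists N0 zN.
  rewrite -(mask_eval_eq0_exp D zP (coprime_dvdr eN rN)) -mulf_eq0.
  by move/eqP.
have /eqP/cards1P[w wP] := reps1 _ (ltn_pmod (c' + r * d) N0).
have : (c', d) \in [set w] by rewrite -wP inE c'C dD /= modn_mod.
have : (c, d') \in [set w].
  rewrite -wP inE cC d'D /= modn_mod; apply/eqP.
  have rdE : r * d = r * ((d - d' : 'Z_M)%R + d') %[mod N].
    by rewrite -[in RHS]modnMmr val_ZpB_add // modnMmr.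
  rewrite -modnDml -(val_ZpB_add c c' M1 NM) modnDml -addnA -modnDml xy modnDml.
  by rewrite -[in RHS]modnDmr rdE modnDmr mulnDr addnCA.
by rewrite !inE => /eqP<- /eqP[-> ->].
Qed.

(** Pigeonhole: an injective map from [N] pairs to [N] residues is onto. *)
Lemma tiling_mod_inj M N (C D : {set 'Z_M}) : 0 < N -> #|C| * #|D| = N ->
  (forall c c' d d', c \in C -> c' \in C -> d \in D -> d' \in D ->
     c + d = c' + d' %[mod N] -> c = c' /\ d = d') ->
  tiling_mod N C D.
Proof.
move=> N0 card inj; apply/tiling_mod_reps => // x xN.
pose h (u : 'Z_M * 'Z_M) : 'I_N := Ordinal (ltn_pmod (u.1 + u.2) N0).
have hinj : {in setX C D &, injective h}.
  move=> [c d] [c' d']; rewrite !in_setX => /andP[/= cC dD] /andP[/= c'C d'D].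
  by move=> /(congr1 val) /= e; have [-> ->] := inj c c' d d' cC c'C dD d'D e.
have : Ordinal xN \in h @: setX C D.
  suff -> : h @: setX C D = [set: 'I_N] by rewrite inE.
  by apply/eqP; rewrite eqEcard subsetT cardsT card_ord card_in_imset // cardsX card /=.
case/imsetP=> u; rewrite inE => /andP[uC uD] /(congr1 val) /= xE.
apply/eqP/cards1P; exists u; apply/setP => v; rewrite !inE mul1n.
apply/and3P/eqP => [[vC vD /eqP vx] | ->]; last first.
  by split=> //; apply/eqP; rewrite xE modn_mod.
have [] := inj v.1 u.1 v.2 u.2 vC uC vD uD; first by rewrite vx xE modn_mod.
by case: v u {vC vD vx uC uD xE} => [v1 v2] [u1 u2] /= -> ->.
Qed.

(** * Invariance under translation *)

Lemma mask_eval_translate M (A : {set 'Z_M}) (t : 'Z_M) (z : algC) :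
  1 < M -> (z ^+ M = 1)%R ->
  (mask_eval (translate A t) z = mask_eval A z * z ^+ t)%R.
Proof.
move=> M1 zM; rewrite /mask_eval big_imset; last by move=> x y _ _ /addIr.
rewrite big_distrl; apply: eq_bigr => a _.
rewrite -[RHS]exprD; apply: eq_expr_mod zM _.
by rewrite val_ZpD // modn_mod.
Qed.

Lemma Cyclotomic_dvd_translate M (A : {set 'Z_M}) (t : 'Z_M) d :
  1 < M -> d %| M ->
  ('Phi_d %| mask_poly (translate A t))%R = ('Phi_d %| mask_poly A)%R.
Proof.
move=> M1 dM; have [z zP] := C_prim_root_exists (dvdn_gt0 (ltnW M1) dM).
rewrite !(Cyclotomic_dvd_mask _ zP) mask_eval_translate //; last first.
  by apply/eqP; rewrite -(prim_order_dvd zP).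
by rewrite mulf_eq0 expf_eq0 (prim_root_eq0 zP) gtn_eqF
  ?(prim_order_gt0 zP) // andbF orbF.
Qed.

Lemma card_translate M (A : {set 'Z_M}) (t : 'Z_M) : #|translate A t| = #|A|.
Proof. by rewrite card_imset //; apply: addIr. Qed.

Lemma tiling_mod_translate M (A B : {set 'Z_M}) (t : 'Z_M) :
  1 < M -> tiling_mod M A B -> tiling_mod M (translate A t) B.
Proof.
move=> M1 /(tiling_modP _ _ (ltnW M1))[card vanish].
apply/(tiling_modP _ _ (ltnW M1)); rewrite card_translate; split=> // z zM z1.
by rewrite mask_eval_translate // mulrAC vanish // mul0r.
Qed.

Lemma Div_translate M (A : {set 'Z_M}) (t : 'Z_M) :
  {subset Div (translate A t) <= Div A}.
Proof.
move=> m /DivP[_ [_ [/imsetP[a aA ->] /imsetP[a' a'A ->] ->]]].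
by apply/DivP; exists a, a'; rewrite opprD addrACA subrr addr0.
Qed.

(** * Sums over consecutive integers *)

Lemma sum_window m (g : nat -> algC) s :
  (\sum_(r < m) g (r + s.+1)%N + g s = \sum_(r < m) g (r + s)%N + g (m + s)%N)%R.
Proof.
transitivity (\sum_(r < m.+1) g (r + s)%N)%R; last by rewrite big_ord_recr.
rewrite big_ord_recl /= addrC; congr (_ + _)%R.
by apply: eq_bigr => r _; rewrite /= addSnnS.
Qed.

Lemma sum_shift P (g : nat -> algC) s : (forall r, g (r + P) = g r) ->
  (\sum_(r < P) g (r + s)%N = \sum_(r < P) g r)%R.
Proof.
move=> gP; elim: s => [|s IH]; first by under eq_bigr do rewrite addn0.
by rewrite -IH; apply: (@addIr _ (g s)); rewrite sum_window addnC gP.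
Qed.

Lemma sum_periodic q m (g : nat -> algC) : (forall r, g (r + q) = g r) ->
  (\sum_(r < m * q) g r = m%:R * \sum_(r < q) g r)%R.
Proof.
move=> gq; elim: m => [|m IH]; first by rewrite mul0r big_ord0.
rewrite big_split_ord /= -natr1 mulrDl mul1r addrC; congr (_ + _)%R.
by rewrite -IH; apply: eq_bigr => r _; rewrite /= addnC gq.
Qed.

(** * Slabs and layers for one prime [p], with an abstract coordinate [pi] *)

Section Slab.

Variables (p k c M : nat) (pi : 'Z_M -> nat).

Local Notation q := (p ^ k).
Local Notation P := (p ^ k.+1).

Hypotheses (p_prime : prime p) (co_pc : coprime p c) (M_gt1 : 1 < M).
Hypotheses (defM : M = P * c) (pi_lt : forall a, pi a < P).
Hypothesis piE : forall a : 'Z_M, a = pi a * c %[mod P].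

Definition slab (A : {set 'Z_M}) : {set 'Z_M} := [set a in A | pi a < q].

(** This is f_z(r) of the overview: by [piE], the congruence says that [pi a] is [r] modulo [P]. The
    index is any natural number, so shifts by [q] need no wrapping. *)
Definition layer (A : {set 'Z_M}) (z : algC) (r : nat) : algC :=
  (\sum_(a in A | a == r * c %[mod P]) z ^+ (a : nat))%R.

Let p_gt0 : 0 < p := prime_gt0 p_prime.
Let q_gt0 : 0 < q. Proof. by rewrite expn_gt0 p_gt0. Qed.
Let P_gt0 : 0 < P. Proof. by rewrite expn_gt0 p_gt0. Qed.
Let c_gt0 : 0 < c.
Proof. by have := ltnW M_gt1; rewrite defM muln_gt0 P_gt0. Qed.
Let PE : P = p * q. Proof. exact: expnS. Qed.
Let P_dvdM : P %| M. Proof. by rewrite defM dvdn_mulr. Qed.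
Let qc_gt0 : 0 < q * c. Proof. by rewrite muln_gt0 q_gt0. Qed.
Let defM' : M = p * (q * c). Proof. by rewrite defM PE mulnA. Qed.
Let qc_dvdM : q * c %| M. Proof. by rewrite defM' dvdn_mull. Qed.
Let q_dvdP : q %| P. Proof. by rewrite PE dvdn_mull. Qed.

(** [c] is invertible modulo every power of [p]; the exponents for [P] and for [q] both occur
    below. *)
Lemma eq_mulc_mod j x y : x * c = y * c %[mod p ^ j] -> x = y %[mod p ^ j].
Proof.
wlog le : x y / x <= y.
  move=> W; case/orP: (leq_total x y) => le e; first exact: W.
  by apply/esym/W.
move=> /esym/eqP; rewrite eqn_mod_dvd ?leq_mul2r ?le ?orbT // -mulnBl.
rewrite Gauss_dvdl ?coprimeXl // => dv; apply/esym/eqP.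
by rewrite eqn_mod_dvd.
Qed.

Lemma layer_mod A z r s : r = s %[mod P] -> layer A z r = layer A z s.
Proof.
move=> rs; apply: eq_bigl => a; congr (_ && (_ == _)).
by rewrite -modnMml rs modnMml.
Qed.

(** Since [w ^+ P = 1], the factor [w ^+ a] is constant on a layer, equal to [w ^+ (r * c)]. *)
Lemma mask_eval_layers (A : {set 'Z_M}) (z w : algC) m :
  m <= P -> (w ^+ P = 1)%R ->
  (mask_eval [set a in A | (pi a < m)%N] (z * w)
    = \sum_(r < m) layer A z r * w ^+ (r * c))%R.
Proof.
move=> mP wP; rewrite /mask_eval.
have [m0|m0] := posnP m.
  by rewrite m0 big_ord0 big1 // => a; rewrite inE andbF.
(* The default of [insubd] is harmless: only elements with [pi a < m] are summed. *)
pose h a : 'I_m := insubd (Ordinal m0) (pi a).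
have piP (a : 'Z_M) (r : 'I_m) : (a == r * c %[mod P]) = (pi a == r).
  rewrite piE; apply/eqP/eqP => [/eq_mulc_mod|-> //].
  by rewrite !modn_small // (leq_trans (ltn_ord r)).
rewrite (partition_big h xpredT) //=; apply: eq_bigr => r _.
rewrite big_distrl; apply: eq_big => [a|a /andP[]].
  rewrite inE -andbA piP; congr (_ && _).
  apply/andP/eqP => [[am /eqP<-]|ar]; first by rewrite val_insubd am.
  rewrite ar ltn_ord; split=> //; apply/eqP/val_inj.
  by rewrite val_insubd ar ltn_ord.
rewrite inE => /andP[_ am] /eqP <-; rewrite exprMn val_insubd am.
by congr (_ * _)%R; apply: eq_expr_mod wP _; rewrite piE.
Qed.

Lemma mask_eval_all_layers (A : {set 'Z_M}) (z w : algC) : (w ^+ P = 1)%R ->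
  (mask_eval A (z * w) = \sum_(r < P) layer A z r * w ^+ (r * c))%R.
Proof.
move=> wP; rewrite -mask_eval_layers //; congr mask_eval.
by apply/setP => a; rewrite inE pi_lt andbT.
Qed.

Lemma layer_periodic (A : {set 'Z_M}) d (z : algC) :
  d %| c -> d.-primitive_root%R z -> ('Phi_(d * P)%N %| mask_poly A)%R ->
  forall r, layer A z (r + q) = layer A z r.
Proof.
move=> dc zd PhiA.
have dP : coprime d P.
  by rewrite coprime_sym coprimeXl // (coprime_dvdr dc).
(* Layer [r] carries the character [w ^+ (r * c)]; replacing [w] by [w ^+ u] turns it into
   [w ^+ r]. *)
have [u uc] : exists u, u * c = 1 %[mod P].
  have [u v uv _] := egcdnP P c_gt0; exists u.
  rewrite uv; have -> : gcdn c P = 1.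
    by apply/eqP; rewrite -/(coprime c P) coprime_sym coprimeXl.
  by rewrite modnMDl.
pose g r := (layer A z (r + q) - layer A z r)%R.
suff g0 r : r < P -> g r = 0%R.
  move=> r; rewrite -(layer_mod A z (modn_mod r P)).
  rewrite -(@layer_mod A z (r %% P + q)); last by rewrite modnDml.
  by apply/eqP; rewrite -subr_eq0 -/(g _) g0 // ltn_mod.
move=> rP; apply: fourier_eq0 (rP) => w wP.
pose S := (\sum_(r < P) layer A z r * w ^+ r)%R.
have SE : S = mask_eval A (z * w ^+ u)%R.
  rewrite mask_eval_all_layers; last by rewrite exprAC wP expr1n.
  apply: eq_bigr => s _; congr (_ * _)%R; rewrite -exprM.
  by apply: eq_expr_mod wP _; rewrite mulnCA -modnMmr uc modnMmr muln1.
have shift : (w ^+ q * \sum_(r < P) layer A z (r + q)%N * w ^+ r = S)%R.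
  rewrite /S -(@sum_shift P (fun r => layer A z r * w ^+ r)%R q) => [|s]; last first.
    rewrite exprD wP mulr1; congr (_ * _)%R.
    by apply: layer_mod; rewrite modnDr.
  by rewrite big_distrr; apply: eq_bigr => s _ /=; rewrite exprD; ring.
have w0 : (w ^+ q != 0)%R.
  apply/eqP => wq0; have : (w ^+ P = 0)%R by rewrite PE mulnC exprM wq0 expr0n gtn_eqF.
  by rewrite wP => /eqP; rewrite oner_eq0.
apply: (mulfI w0); rewrite mulr0 /g.
under eq_bigr do rewrite mulrBl.
rewrite sumrB mulrBr shift -/S -[X in (X - _)%R]mul1r -mulrBl.
(* The transform of [g] times [w ^+ q] is [(1 - w ^+ q) * S]. Either the first factor is 0, or [w]
   has exact order [P] and [S], a value of A at a root of order [d * P], is 0. *)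
have [->|wq1] := eqVneq (w ^+ q)%R 1%R; first by rewrite subrr mul0r.
have wprim : P.-primitive_root%R w.
  have [m wm /dvdn_pfactor-/(_ p_prime)[j jk mE]] := prim_order_exists P_gt0 wP.
  have [jk'|kj] := leqP j k.
    by case/negP: wq1; rewrite -(prim_order_dvd wm) mE dvdn_exp2l.
  suff -> : k.+1 = j by rewrite -mE.
  by apply/eqP; rewrite eqn_leq jk kj.
have uP : coprime u P.
  have : coprime (u * c) P by rewrite -coprime_modl uc coprime_modl coprime1n.
  by rewrite coprimeMl => /andP[].
suff /eqP : S == 0%R by move->; rewrite mulr0.
rewrite SE -(@Cyclotomic_dvd_mask _ A (d * P)) //.
by apply: prim_root_mul; rewrite ?prim_root_exp_coprime.
Qed.

(** Shifting the index by [q] multiplies the sum [S] by [w ^+ (q * c)], which differs from 1 because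
    [p] does not divide [c]; so [S = 0]. *)
Lemma Phi_dvd_layer_periodic (A : {set 'Z_M}) d (z : algC) :
  d %| c -> d.-primitive_root%R z ->
  (forall r, layer A z (r + q) = layer A z r) ->
  ('Phi_(d * P)%N %| mask_poly A)%R.
Proof.
move=> dc zd per.
have dP : coprime d P.
  by rewrite coprime_sym coprimeXl // (coprime_dvdr dc).
have [w wprim] := C_prim_root_exists P_gt0.
have wP := prim_expr_order wprim.
rewrite (@Cyclotomic_dvd_mask _ A (d * P) (z * w)%R); last exact: prim_root_mul.
rewrite mask_eval_all_layers //; set S := (\sum_(r < P) _)%R.
have : (S = w ^+ (q * c) * S)%R.
  rewrite {1}/S -(@sum_shift P (fun r => layer A z r * w ^+ (r * c))%R q)
    => [|s]; last first.
    rewrite mulnDl exprD [(w ^+ (P * c))%R]exprM wP expr1n mulr1; congr (_ * _)%R.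
    by apply: layer_mod; rewrite modnDr.
  rewrite big_distrr; apply: eq_bigr => s _ /=.
  by rewrite per mulnDl exprD; ring.
move/eqP; rewrite -subr_eq0 -{1}[S]mul1r -mulrBl mulf_eq0 subr_eq0 eq_sym.
rewrite -(prim_order_dvd wprim) PE mulnC dvdn_pmul2l //.
have -> : p %| c = false.
  by apply/negP => pc; move: co_pc; rewrite prime_coprime // pc.
by [].
Qed.

(** Layers and characters both have period [q], so the sum over [P = p * q] indices is [p] copies of
    the sum over the slab. *)
Lemma mask_eval_slab (A : {set 'Z_M}) (z w : algC) :
  (forall r, layer A z (r + q) = layer A z r) -> (w ^+ q = 1)%R ->
  (mask_eval A (z * w) = p%:R * mask_eval (slab A) (z * w))%R.
Proof.
move=> per wq; have wP : (w ^+ P = 1)%R by rewrite PE mulnC exprM wq expr1n.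
rewrite mask_eval_all_layers // mask_eval_layers //; last exact: dvdn_leq.
rewrite PE (@sum_periodic q p (fun r => layer A z r * w ^+ (r * c))%R) // => r.
rewrite per mulnDl exprD [(w ^+ (q * c))%R]exprM.
by rewrite wq expr1n mulr1.
Qed.

(** Adding [t] lowers the coordinate by [s] modulo [P] and multiplies each power by [z ^+ t], as
    [z ^+ M = 1]. *)
Lemma layer_translate (A : {set 'Z_M}) (z : algC) s r : (z ^+ c = 1)%R ->
  let t : 'Z_M := (- (s * c)%N%:R)%R in
  layer (translate A t) z r = (layer A z (r + s) * z ^+ t)%R.
Proof.
move=> zc t; have zM : (z ^+ M = 1)%R by rewrite defM mulnC exprM zc expr1n.
rewrite /layer big_mkcondr big_imset; last by move=> x y _ _ /addIr.
rewrite [in RHS]big_mkcondr big_distrl; apply: eq_bigr => a _.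
have aE : a = (a + t)%R + s * c %[mod P].
  have {1}-> : a = (a + t + (s * c)%:R)%R by rewrite subrK.
  rewrite val_ZpD // modn_dvdm // -[LHS]modnDmr val_Zp_nat // modn_dvdm //.
  by rewrite modnDmr.
rewrite aE mulnDl eqn_modDr; case: ifP => _; last by rewrite [RHS]mul0r.
rewrite -[RHS]exprD; apply: eq_expr_mod zM _.
by rewrite val_ZpD // modn_mod.
Qed.

(** Translation by [-(s * c)] turns the slab into the window of [q] layers starting at [s].
    Neighbouring windows differ by exchanging [g s] for [g (q + s)], and [w ^+ q = 1] makes their
    characters equal. *)
Lemma layer_periodic_windows (A : {set 'Z_M}) (z w : algC) :
  (z ^+ c = 1)%R -> (w ^+ q = 1)%R ->
  (forall t, mask_eval (slab (translate A t)) (z * w) = 0)%R ->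
  forall r, layer A z (r + q) = layer A z r.
Proof.
move=> zc wq win r.
have wP : (w ^+ P = 1)%R by rewrite PE mulnC exprM wq expr1n.
have w0 : w != 0%R.
  by apply: contra_eq_neq wq => ->; rewrite expr0n gtn_eqF // eq_sym oner_eq0.
have z0 : z != 0%R.
  by apply: contra_eq_neq zc => ->; rewrite expr0n gtn_eqF // eq_sym oner_eq0.
pose g s := (layer A z s * w ^+ (s * c))%R.
have win0 s : (\sum_(r < q) g (r + s)%N = 0)%R.
  have := win (- (s * c)%N%:R)%R; rewrite mask_eval_layers //; last exact: dvdn_leq.
  under eq_bigr do rewrite layer_translate //.
  set t := nat_of_ord _ => e; apply: (mulIf (expf_neq0 t z0)).
  move/(congr1 (fun x => x * w ^+ (s * c))%R): e; rewrite !mul0r => e; apply: etrans e.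
  rewrite !big_distrl; apply: eq_bigr => j _; rewrite /g mulnDl exprD /=; ring.
have := sum_window q g r; rewrite !win0 !add0r /g addnC mulnDl exprD.
rewrite [(w ^+ (q * c))%R]exprM wq expr1n mulr1.
by move/(mulIf (expf_neq0 _ w0)).
Qed.

(** This is [mask_eval_slab] at [z = w = 1], where mask values are cardinalities. *)
Lemma card_slab (A : {set 'Z_M}) : ('Phi_P %| mask_poly A)%R ->
  #|A| = p * #|slab A|.
Proof.
move=> PhiA; have z1 : 1.-primitive_root%R (1 : algC)%R.
  have [z zP] := @C_prim_root_exists 1 isT.
  by move: (zP); rewrite (prim_expr_order zP : z = 1%R).
have card (C : {set 'Z_M}) : mask_eval C (1 * 1)%R = (#|C|%:R)%R.
  by rewrite /mask_eval mulr1; under eq_bigr do rewrite expr1n; rewrite sumr_const.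
apply/eqP; rewrite -(eqr_nat algC) natrM -!card -mask_eval_slab ?expr1n //.
by apply: layer_periodic z1 _; rewrite ?dvd1n // mul1n.
Qed.

(** * Slab tilings and cyclotomic divisors: (i) and (ii) *)

Lemma tiling_slab_Phi (A B : {set 'Z_M}) :
  tiling_mod M A B -> ('Phi_P %| mask_poly A)%R ->
  (forall d, d %| c -> ('Phi_(d * P)%N %| mask_poly A)%R \/
     forall j, j <= k -> ('Phi_(d * p ^ j)%N %| mask_poly B)%R) ->
  tiling_mod (q * c) (slab A) B.
Proof.
move=> /(tiling_modP _ _ (ltnW M_gt1))[cardAB vanish] PhiA dich.
apply/tiling_modP => //; split=> [|z zqc z1].
  apply/eqP; rewrite -(eqn_pmul2l p_gt0) mulnA -card_slab // cardAB.
  by apply/eqP.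
have co_cq : coprime c q by rewrite coprime_sym coprimeXl.
(* Chinese remainders split [z] into a [c]-th root of unity and a [q]-th root of unity. *)
pose s := chinese c q 1 0; pose t := chinese c q 0 1.
have zE : z = (z ^+ s * z ^+ t)%R.
  rewrite -exprD -[LHS]expr1; apply: eq_expr_mod zqc _; apply/eqP.
  rewrite mulnC chinese_remainder //.
  rewrite -modnDml -(modnDmr _ t c) chinese_modl // -[in X in _ && X]modnDml.
  rewrite -(modnDmr _ t q) chinese_modr // chinese_modr // chinese_modl //.
  by rewrite !modnDml !modnDmr addn0 add0n !eqxx.
have zc : ((z ^+ s) ^+ c = 1)%R.
  have /dvdnP[s' sE] : q %| s by apply/eqP; rewrite chinese_modr // mod0n.
  by rewrite sE -exprM -mulnA mulnC exprM zqc expr1n.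
have wq : ((z ^+ t) ^+ q = 1)%R.
  have /dvdnP[t' tE] : c %| t by apply/eqP; rewrite chinese_modl // mod0n.
  by rewrite tE -exprM -mulnA [c * q]mulnC mulnC exprM zqc expr1n.
have [d zd dc] := prim_order_exists c_gt0 zc.
have [e we /dvdn_pfactor-/(_ p_prime)[j jk eE]] := prim_order_exists q_gt0 wq.
(* In the first case A(z) is [p] times the slab value, so a zero of A passes to the slab; in the
   second B vanishes at [z], whose order is [d * p ^ j]. *)
have [PhidA|/(_ j jk)] := dich d dc.
  have := mask_eval_slab (layer_periodic dc zd PhidA) wq; rewrite -zE => AE.
  have zM : (z ^+ M = 1)%R by rewrite defM' mulnC exprM zqc expr1n.
  have /eqP := vanish z zM z1; rewrite AE -mulrA mulf_eq0 pnatr_eq0 gtn_eqF //=.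
  by move/eqP.
rewrite (@Cyclotomic_dvd_mask _ B (d * p ^ j) z) => [/eqP->|]; first by rewrite mulr0.
rewrite zE -eE; apply: prim_root_mul => //.
by rewrite eE (coprime_dvdl dc) // coprime_sym coprimeXl.
Qed.

Lemma Phi_tiling_slab (A B : {set 'Z_M}) : ('Phi_P %| mask_poly A)%R ->
  (forall t, tiling_mod (q * c) (slab (translate A t)) B) ->
  forall d, d %| c -> ('Phi_(d * P)%N %| mask_poly A)%R \/
     forall j, j <= k -> ('Phi_(d * p ^ j)%N %| mask_poly B)%R.
Proof.
move=> PhiA tile d dc.
have [|PhidA] := boolP ('Phi_(d * P)%N %| mask_poly A)%R; [by left | right=> j jk].
(* If B does not vanish at roots of order [d * p ^ j], the slab of every translate must, and the
   windows make the layers periodic. *)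
apply: contraNT PhidA => PhiB.
have [z zd] := C_prim_root_exists (dvdn_gt0 c_gt0 dc).
have pj0 : 0 < p ^ j by rewrite expn_gt0 p_gt0.
have [w wj] := C_prim_root_exists pj0.
have zc : (z ^+ c = 1)%R by apply/eqP; rewrite -(prim_order_dvd zd).
have wq : (w ^+ q = 1)%R by apply/eqP; rewrite -(prim_order_dvd wj) dvdn_exp2l.
have zw : (d * p ^ j).-primitive_root%R (z * w)%R.
  by apply: prim_root_mul => //; rewrite (coprime_dvdl dc) // coprime_sym coprimeXl.
rewrite (Cyclotomic_dvd_mask B zw) in PhiB.
(* Tilings say nothing at 1, but this forces [d = 1], where the claim is [PhiA]. *)
have [zw1|zw1] := eqVneq (z * w)%R 1%R.
  have : d * p ^ j %| 1 by rewrite (prim_order_dvd zw) zw1 expr1n.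
  by rewrite dvdn1 muln_eq1 => /andP[/eqP-> _]; rewrite mul1n.
apply: (Phi_dvd_layer_periodic dc zd); apply: (layer_periodic_windows zc wq) => t.
have [_ /(_ (z * w)%R)] := (tiling_modP (slab (translate A t)) B qc_gt0).1 (tile t).
rewrite exprMn [in X in (_ * X)%R]exprM wq expr1n [q * c]mulnC exprM zc expr1n mul1r.
by move=> /(_ erefl zw1)/eqP; rewrite mulf_eq0 (negPf PhiB) orbF => /eqP.
Qed.

(** * Slab tilings and divisor sets: (i) and (iii) *)

Lemma gcd_nondvd x : ~~ (P %| x) -> gcdn x M = gcdn x (q * c).
Proof.
move=> Px; apply/eqP; rewrite eqn_dvd !dvdn_gcd !dvdn_gcdl /=.
rewrite (dvdn_trans (dvdn_gcdr x (q * c)) qc_dvdM) andbT.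
set g := gcdn x M; have gx : g %| x := dvdn_gcdl x M.
(* As [P] does not divide [x], the [p]-part of [g] is at most [p ^ k] and so divides [q]. *)
have [j jk gE] : exists2 j, j <= k & gcdn g P = p ^ j.
  have /dvdn_pfactor-/(_ p_prime)[j jk gE] := dvdn_gcdr g P.
  exists j => //; rewrite -ltnS ltn_neqAle jk andbT.
  apply: contraNneq Px => jE; rewrite -jE -gE.
  exact: dvdn_trans (dvdn_gcdl _ _) gx.
have gM : g %| P * c by rewrite -defM dvdn_gcdr.
apply: (@dvdn_trans (gcdn g P * gcdn g c)).
  rewrite muln_gcdl dvdn_gcd dvdn_mulr //= muln_gcdr dvdn_gcd gM andbT.
  by rewrite dvdn_mull.
by rewrite gE dvdn_mul ?dvdn_exp2l ?dvdn_gcdr.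
Qed.

(** The [p]-parts of the two gcds are [P] and [q], and their parts prime to [p] agree. *)
Lemma gcd_dvd x : P %| x -> gcdn x M = p * gcdn x (q * c).
Proof.
case/dvdnP=> y ->; rewrite defM [y * P]mulnC -muln_gcdr PE -!mulnA.
congr (_ * _); rewrite [p * (q * y)]mulnCA -muln_gcdr; congr (_ * _).
by rewrite ![gcdn _ c]gcdnC Gauss_gcdr // coprime_sym.
Qed.

(** Translating [a'] to 0 puts 0 and [a - a'] in one slab, both having coordinate 0. Modulo [q * c]
    their difference has gcd [m %/ p], as does [b - b'], so Sands gives [b = b']. *)
Lemma Div_tiling_slab (A B : {set 'Z_M}) :
  (forall t, tiling_mod (q * c) (slab (translate A t)) B) ->
  forall m, P %| m -> m %| M -> m \in Div A -> m %/ p \notin Div B.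
Proof.
move=> tile m Pm mM /DivP[a [a' [aA a'A mE]]].
apply/negP => /DivP[b [b' [bB b'B mpE]]].
have pi0 (x : 'Z_M) : P %| x -> pi x = 0.
  move=> /eqP x0; have := piE x; rewrite x0 -(mod0n P) -{1}(mul0n c) => /esym.
  by move/eq_mulc_mod; rewrite mod0n modn_small.
have Px : P %| (a - a' : 'Z_M)%R by apply: dvdn_trans Pm _; rewrite mE dvdn_gcdl.
have inslab (x : 'Z_M) : x \in A -> P %| (x - a')%R ->
    (x - a')%R \in slab (translate A (- a')%R).
  by move=> xA Px'; rewrite inE pi0 // q_gt0 andbT; apply/imsetP; exists x.
have p_mE : m = p * gcdn (a - a' : 'Z_M)%R (q * c) by rewrite mE gcd_dvd.
have gE : gcdn (a - a' : 'Z_M)%R (q * c) = gcdn (b - b' : 'Z_M)%R (q * c).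
  have <- : gcdn (gcdn (b - b' : 'Z_M)%R M) (q * c) = gcdn (b - b' : 'Z_M)%R (q * c).
    by rewrite -gcdnA (gcdn_idPr qc_dvdM).
  rewrite -mpE p_mE mulKn //; apply/esym/gcdn_idPl; exact: dvdn_gcdr.
have [||_ bb'] := tiling_mod_gcd_inj M_gt1 qc_dvdM (tile (- a')%R)
   (inslab a aA Px) (inslab a' a'A _) bB b'B.
- by rewrite subrr dvdn0.
- by rewrite subrr subr0.
(* Now [m %/ p] would equal [M], although [m] divides [M]. *)
move: mpE; rewrite bb' subrr gcd0n => mpM.
have : m %/ p < M.
  apply: leq_trans (dvdn_leq (ltnW M_gt1) mM).
  by rewrite ltn_Pdiv ?prime_gt1 // (dvdn_gt0 (ltnW M_gt1) mM).
by rewrite mpM ltnn.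
Qed.

(** For a collision modulo [q * c], [x] and [y] have equal gcds with [q * c]. If [P] divides both or
    neither, their gcds with [M] agree and Sands applies to A and B; if [P] divides only [x], [nDiv]
    is violated. *)
Lemma tiling_slab_Div (A B : {set 'Z_M}) :
  tiling_mod M A B -> ('Phi_P %| mask_poly A)%R ->
  (forall m, P %| m -> m %| M -> m \in Div A -> m %/ p \notin Div B) ->
  tiling_mod (q * c) (slab A) B.
Proof.
move=> AB PhiA nDiv; have [cardAB _] := (tiling_modP _ _ (ltnW M_gt1)).1 AB.
apply: tiling_mod_inj => // [|a a' b b'].
  apply/eqP; rewrite -(eqn_pmul2l p_gt0) mulnA -card_slab // cardAB.
  by apply/eqP.
rewrite !inE => /andP[aA aq] /andP[a'A a'q] bB b'B abE.
set x := nat_of_ord (a - a' : 'Z_M)%R; set y := nat_of_ord (b' - b : 'Z_M)%R.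
have xyE : x = y %[mod q * c].
  apply/eqP; rewrite -(eqn_modDr (a' + b)) addnA -[X in X == _]modnDml.
  rewrite val_ZpB_add // modnDml abE addnCA -[X in _ == X]modnDmr val_ZpB_add //.
  by rewrite modnDmr.
have gxy : gcdn x (q * c) = gcdn y (q * c).
  by rewrite -gcdn_modl xyE gcdn_modl.
have sands : gcdn x M = gcdn y M -> a = a' /\ b = b'.
  by move=> e; have [//|-> ->] := tiling_mod_gcd_inj M_gt1 (dvdnn M) AB aA a'A b'B bB.
have [Px|Px] := boolP (P %| x).
  have [Py|Py] := boolP (P %| y).
    by apply: sands; rewrite !gcd_dvd // gxy.
  have Pg : P %| gcdn x M by rewrite dvdn_gcd Px.
  have gA : gcdn x M \in Div A by apply/DivP; exists a, a'.
  case/negP: (nDiv _ Pg (dvdn_gcdr _ _) gA).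
  by apply/DivP; exists b', b; rewrite gcd_dvd // mulKn // gxy -gcd_nondvd.
(* [P] cannot divide [y] alone: then [q] would divide [x], and two coordinates below [q] that agree
   modulo [q] are equal, so [P] would divide [x]. *)
have qx : ~~ (q %| x).
  apply: contraNN Px => /dvdnP[x' xE].
  have aE : a = a' %[mod q].
    by rewrite -(val_ZpB_add a a' M_gt1 (dvdn_trans q_dvdP P_dvdM)) -/x xE modnMDl.
  have piq (v : 'Z_M) : v = pi v * c %[mod q].
    by rewrite -(modn_dvdm _ q_dvdP) piE modn_dvdm.
  have piaE : pi a = pi a'.
    have := aE; rewrite piq [RHS]piq => /eq_mulc_mod.
    by rewrite !modn_small.
  have := val_ZpB_add a a' M_gt1 P_dvdM; rewrite -/x piE piaE -piE.
  by move/eqP; rewrite -{2}[nat_of_ord a']add0n eqn_modDr mod0n.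
have Py : ~~ (P %| y).
  apply: contraNN qx => Py; have qy : q %| y := dvdn_trans q_dvdP Py.
  by rewrite /dvdn -(modn_dvdm _ (dvdn_mulr c (dvdnn q))) xyE modn_dvdm ?dvdn_mulr.
by apply: sands; rewrite !gcd_nondvd // gxy.
Qed.

End Slab.

(** * From slabs back to array coordinates, and the equivalence *)

Lemma prod_Cyclotomic_chain_dvd p k d (s : {poly int}) : prime p -> 0 < d ->
  ((\prod_(1 <= j < k.+2) 'Phi_((d * p ^ k.+1) %/ p ^ j)%N) %| s)%R <->
  (forall j, j <= k -> ('Phi_(d * p ^ j)%N %| s)%R).
Proof.
move=> p_pr d0; have p0 := prime_gt0 p_pr; have pX j : 0 < p ^ j by rewrite expn_gt0 p0.
have quoE j : j <= k.+1 -> (d * p ^ k.+1) %/ p ^ j = d * p ^ (k.+1 - j).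
  by move=> jk; rewrite -{1}(subnK jk) expnD mulnA mulnK.
have -> : (\prod_(1 <= j < k.+2) 'Phi_((d * p ^ k.+1) %/ p ^ j)%N =
    \prod_(e <- [seq (d * p ^ j)%N | j <- index_iota 0 k.+1]) 'Phi_e)%R.
  rewrite big_map big_add1 [RHS]big_nat_rev !big_mkord.
  by apply: eq_bigr => j _; rewrite quoE.
rewrite prod_Cyclotomic_dvd.
- split=> [/allP Phi_s j jk | Phi_s].
    by apply: Phi_s; apply/mapP; exists j; rewrite ?mem_index_iota.
  by apply/allP => _ /mapP[j jk ->]; apply: Phi_s; rewrite mem_index_iota in jk.
- rewrite map_inj_uniq ?iota_uniq // => i j /eqP.
  by rewrite eqn_pmul2l // eqn_exp2l ?prime_gt1 // => /eqP.
by move=> _ /mapP[j _ ->]; rewrite muln_gt0 d0 pX.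
Qed.

Lemma array_coord_lt K (p n : 'I_K -> nat) M i (a : 'Z_M) :
  (forall j, prime (p j)) -> array_coord p n i a < p i ^ n i.
Proof.
move=> p_pr; rewrite /array_coord; case: pickP => [e _|_]; first exact: ltn_ord.
by rewrite expn_gt0 prime_gt0.
Qed.

Lemma array_coord_mod K (p n : 'I_K -> nat) M i (a : 'Z_M) :
  (forall j, prime (p j)) -> injective p -> 1 < M -> M = \prod_j p j ^ n j ->
  a = array_coord p n i a * (M %/ p i ^ n i) %[mod p i ^ n i].
Proof.
move=> p_pr p_inj M1 defM.
have [e [eP _]] := array_coords_exists_unique p_pr p_inj M1 defM a.
rewrite (array_coordE p_pr p_inj M1 defM i eP).
have PM : p i ^ n i %| M by rewrite defM (bigD1 i) //= dvdn_mulr.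
move/eqP: eP; rewrite -natr_sum => /(congr1 (@nat_of_ord _)) ->.
rewrite val_Zp_nat // modn_dvdm // (bigD1 i) //= -modnDmr.
(* Every term of the array expansion other than the [i]-th is divisible by [p i ^ n i]. *)
have /eqP-> : p i ^ n i %| \sum_(j | j != i) e j * (M %/ p j ^ n j).
  apply: dvdn_sum => j ji; rewrite dvdn_mull // {1}defM (bigD1 j) //= mulKn.
    by rewrite (bigD1 i) 1?eq_sym //= dvdn_mulr.
  by rewrite expn_gt0 prime_gt0.
by rewrite addn0.
Qed.

Theorem mainTheorem6 (K : nat) (p n : 'I_K -> nat) (M : nat) (i : 'I_K)
    (A B : {set 'Z_M})
    (p_prime : forall j, prime (p j)) (p_inj : injective p)
    (n_gt0 : forall j, 1 <= n j) (defM : M = \prod_(j < K) p j ^ n j)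
    (AB_tiling : tiling A B) (Phi_A : ('Phi_(p i ^ n i)%N %| mask_poly A)%R) :
  [<-> (forall t : 'Z_M,
          tiling_mod (M %/ p i) (low_part p n i (translate A t)) B);
       (forall d : nat, p i ^ n i %| d -> d %| M ->
          ('Phi_d %| mask_poly A)%R \/
          ((\prod_(1 <= k < (n i).+1) 'Phi_(d %/ p i ^ k)%N) %| mask_poly B)%R);
       (forall m : nat, p i ^ n i %| m -> m %| M ->
          m \in Div A -> m %/ p i \notin Div B)].
Proof.
pose c := M %/ p i ^ n i; pose k := (n i).-1.
have nE : n i = k.+1 by rewrite prednK.
have p_gt0 := prime_gt0 (p_prime i).
have P_gt0 : 0 < p i ^ n i by rewrite expn_gt0 p_gt0.
have PM : p i ^ n i %| M by rewrite defM (bigD1 i) //= dvdn_mulr.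
have M_gt0 : 0 < M by rewrite defM prodn_gt0 // => j; rewrite expn_gt0 prime_gt0.
have M_gt1 : 1 < M.
  apply: leq_trans (dvdn_leq M_gt0 PM).
  by rewrite nE -(exp1n k.+1) ltn_exp2r // prime_gt1.
have co_pc : coprime (p i) c.
  rewrite /c {1}defM (bigD1 i) //= mulKn //.
  apply: (big_ind (coprime _)) => [|x y cx cy|j ji].
  - exact: coprimen1.
  - by rewrite coprimeMr cx.
  rewrite coprimeXr // prime_coprime // dvdn_prime2 //.
  by apply: contraNN ji => /eqP/p_inj->.
pose coord := array_coord (M := M) p n i.
have coord_lt a : coord a < p i ^ k.+1 by rewrite -nE array_coord_lt.
have coordE (a : 'Z_M) : a = coord a * c %[mod p i ^ k.+1].
  by rewrite -nE; apply: array_coord_mod.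
have defMc : M = p i ^ k.+1 * c by rewrite -nE mulnC divnK.
have MpE : M %/ p i = p i ^ k * c by rewrite defMc expnS -mulnA mulKn.
(* The bound [<= q - 1] means [< q] because [q] is positive. *)
have lowE C : low_part p n i C = slab (p i) k coord C.
  apply/setP => a; rewrite !inE -/k -/(coord a) subn1 -ltnS prednK //.
  by rewrite expn_gt0 p_gt0.
have AB := tiling_mod_self M_gt1 AB_tiling.
have iE : (forall t, tiling_mod (M %/ p i) (low_part p n i (translate A t)) B) <->
    (forall t, tiling_mod (p i ^ k * c) (slab (p i) k coord (translate A t)) B).
  by split=> tile t; have := tile t; rewrite lowE MpE.
(* The admissible [d] are exactly [e * p i ^ n i] with [e %| c]. *)
have iiE : (forall d, p i ^ n i %| d -> d %| M -> ('Phi_d %| mask_poly A)%R \/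
      ((\prod_(1 <= k < (n i).+1) 'Phi_(d %/ p i ^ k)%N) %| mask_poly B)%R) <->
    (forall d, d %| c -> ('Phi_(d * p i ^ k.+1)%N %| mask_poly A)%R \/
      forall j, j <= k -> ('Phi_(d * p i ^ j)%N %| mask_poly B)%R).
  have c_gt0 : 0 < c by rewrite divn_gt0 // dvdn_leq.
  rewrite nE; split=> dich d.
    move=> dc; have d_gt0 := dvdn_gt0 c_gt0 dc.
    have [||PhiA|PhiB] := dich (d * p i ^ k.+1).
    - by rewrite dvdn_mull.
    - by rewrite defMc mulnC dvdn_mul.
    - by left.
    by right; apply/(prod_Cyclotomic_chain_dvd _ _ (p_prime i) d_gt0).
  case/dvdnP=> e -> eM; have ec : e %| c.
    by rewrite -(@dvdn_pmul2r (p i ^ k.+1)) -?nE // divnK // nE.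
  have e_gt0 := dvdn_gt0 c_gt0 ec.
  have [PhiA|PhiB] := dich e ec; [by left | right].
  exact/(prod_Cyclotomic_chain_dvd _ _ (p_prime i) e_gt0).
have PhiA' t : ('Phi_(p i ^ k.+1)%N %| mask_poly (translate A t))%R.
  by rewrite Cyclotomic_dvd_translate // -nE.
have Phi_i : (forall t, tiling_mod (M %/ p i) (low_part p n i (translate A t)) B) <->
    (forall d, p i ^ n i %| d -> d %| M -> ('Phi_d %| mask_poly A)%R \/
      ((\prod_(1 <= k < (n i).+1) 'Phi_(d %/ p i ^ k)%N) %| mask_poly B)%R).
  split=> [/iE tile | /iiE dich]; first apply/iiE.
    by apply: (Phi_tiling_slab (pi := coord)) tile => //; rewrite -nE.
  apply/iE => t; apply: tiling_slab_Phi => //; first exact: tiling_mod_translate.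
  move=> d dc; have [PhiA|PhiB] := dich d dc; [left | by right].
  by rewrite Cyclotomic_dvd_translate // defMc mulnC dvdn_mul.
(* The step from (ii) to (iii) passes through (i). *)
tfae; first by move/Phi_i.
  move=> /Phi_i/iE tile; rewrite nE.
  exact: (Div_tiling_slab (pi := coord)) tile.
move=> nDiv; apply/iE => t; apply: tiling_slab_Div => //.
  exact: tiling_mod_translate.
move=> m; rewrite -nE => Pm mM /Div_translate; exact: nDiv.
Qed.
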